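(* Let $R$ be a commutative ring with a nonzero unity $1$, and let $M$ be a Noetherian $R$-module. Then for any $R$-submodule $N$ of $M$ there exists $s\in R$ such that $N\in Spec_s({}_RM)$.
   Context: Modules are unital. Write $(N:_RM)=\{r\in R: rM\subseteq N\}$. For a nonzero element $s\in R$, an $R$-submodule $N$ of $M$ is $s$-prime if $s\notin(N:_RM)$ and, for all $r\in R$ and $m\in M$, $rm\in N$ implies $sr\in(N:_RM)$ or $sm\in N$. $Spec_s({}_RM)$ is the set of all $s$-prime $R$-submodules of $M$.
   Formalization: The submodule N is assumed proper (N ≠ M): for N = M one has (N:_R M) = R, so no s satisfies s ∉ (N:_R M) and the claim fails; every proper submodule is covered. *)

(* Defs.v *)
From HB Require Import structures.
From mathcomp Require Import all_boot all_algebra.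
From mathcomp Require Import boolp classical_sets.

Set Implicit Arguments.
Unset Strict Implicit.
Unset Printing Implicit Defensive.

Import GRing.Theory.
Local Open Scope classical_set_scope.
Local Open Scope ring_scope.

Section SPrime.
Variables (R : comNzRingType) (M : lmodType R).

Definition submodule (N : set M) : Prop := GRing.submod_closed [in N].

Definition noetherian_module : Prop :=
  forall F : nat -> set M,
    (forall i, submodule (F i)) ->
    (forall i, F i `<=` F i.+1) ->
    exists n, forall i, (n <= i)%N -> F i = F n.

(* (N :_R M) = {r in R | rM is contained in N} *)
Definition colon (N : set M) : set R :=
  [set r | [set r *: m | m in [set: M]] `<=` N].

(* The notion is only meant for s != 0; this condition is imposed where
   [s_prime] is used. *)
Definition s_prime (s : R) (N : set M) : Prop :=
  [/\ submodule N,
      ~ colon N s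
    & forall (r : R) (m : M), N (r *: m) -> colon N (s * r) \/ N (s *: m)].

Definition Spec (s : R) : set (set M) := [set N | s_prime s N].

End SPrime.

Arguments noetherian_module {R} M.

(* Main.v *)
(** Among the scalars [s] with [sM] not contained in [N], pick one whose
    preimage [(N :_M s) = {m | s m \in N}] is maximal. If [r m \in N] and
    [s r M] is not contained in [N], then [(N :_M s r)] contains both
    [(N :_M s)] and [m]; by maximality it equals [(N :_M s)], so [s m \in N]. *)
Require Import Defs.
From HB Require Import structures.
From mathcomp Require Import all_boot all_algebra.
From mathcomp Require Import boolp classical_sets.

Import GRing.Theory.
Local Open Scope classical_set_scope.
Local Open Scope ring_scope.

Lemma submoduleP (R : comNzRingType) (M : lmodType R) (N : set M) :
  submodule N <->
  N 0 /\ forall (a : R) (u v : M), N u -> N v -> N (a *: u + v).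
Proof.
split=> [[N0 Nlin]|[N0 Nlin]].
  split=> [|a u v Nu Nv]; first exact: set_mem.
  by apply: set_mem; apply: Nlin; apply: mem_set.
split=> [|a u v /set_mem Nu /set_mem Nv]; apply: mem_set => //.
exact: Nlin.
Qed.

Lemma submoduleZ (R : comNzRingType) (M : lmodType R) (N : set M) (a : R)
    (u : M) : submodule N -> N u -> N (a *: u).
Proof. by move=> /submoduleP[N0 Nlin] Nu; rewrite -[_ *: _]addr0; apply: Nlin. Qed.

(** Since [R] is commutative, scaling by [s] is a linear map, and linear preimages of submodules are
    submodules. *)
Lemma submodule_preimage_scale (R : comNzRingType) (M : lmodType R)
    (N : set M) (s : R) : submodule N -> submodule [set m | N (s *: m)].
Proof.
move=> /submoduleP[N0 Nlin]; apply/submoduleP; split=> /= [|a u v Nu Nv].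
  by rewrite scaler0.
by rewrite scalerDr scalerA mulrC -scalerA; apply: Nlin.
Qed.

(** Without a maximal member, every member would have a strictly larger one, giving a chain that
    never stabilises. Indexing by [I] lets the scalar be recovered along with its submodule. *)
Lemma noetherian_maximal (R : comNzRingType) (M : lmodType R)
    (I : Type) (P : I -> Prop) (F : I -> set M) (i0 : I) :
  noetherian_module M -> (forall i, submodule (F i)) -> P i0 ->
  exists2 i, P i & forall j, P j -> F i `<=` F j -> F j `<=` F i.
Proof.
move=> noethM subF Pi0; apply: contrapT => nomax.
have step (x : {i | P i}) :
    exists y : {i | P i}, F (sval x) `<=` F (sval y) /\
                          ~ (F (sval y) `<=` F (sval x)).
  case: x => i Pi; apply: contrapT => noy; apply: nomax.
  exists i => // j Pj Fij; apply: contrapT => nFji.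
  by apply: noy; exists (exist _ j Pj).
(* Choosing successors in the subtype keeps [P] true along the iteration. *)
have [next nextP] := choice step.
pose x n := iter n next (exist _ i0 Pi0).
have [|n|n stab] := noethM (fun n => F (sval (x n))).
- by move=> n; apply: subF.
- by case: (nextP (x n)).
- by case: (nextP (x n)) => _; apply; rewrite -(stab n.+1).
Qed.

Theorem theorem4p6 (R : comNzRingType) (M : lmodType R)
    (noethM : noetherian_module M)
    (N : set M) (subN : submodule N) (properN : N <> [set: M]) :
  exists2 s : R, s != 0 & Spec s N.
Proof.
(* Properness of [N] makes [1] an admissible scalar, so there is something to maximise over. *)
have ncolon1 : ~ colon N 1.
  move=> N1; apply: properN; apply/seteqP; split=> // m _.
  by apply: N1; exists m; rewrite ?scale1r.
have [s ncolon_s smax] := @noetherian_maximal R M R (fun s => ~ colon N s)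
  (fun s => [set m | N (s *: m)]) 1 noethM
  (fun s => @submodule_preimage_scale R M N s subN) ncolon1.
exists s.
  (* The scalar [0] sends all of [M] into [N], so it is not admissible. *)
  apply/eqP => s0; apply: ncolon_s => _ [m _ <-].
  by rewrite s0 scale0r; case/submoduleP: subN.
split=> // r m Nrm; have [|ncolon_sr] := pselect (colon N (s * r)); first by left.
(* Commutativity lets [s] act before [r] for the inclusion; for [m] itself, [r] acts first. *)
right; apply: (smax _ ncolon_sr) => [u Nsu|] /=.
  by rewrite mulrC -scalerA; apply: submoduleZ.
by rewrite -scalerA; apply: submoduleZ.
Qed.
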